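(* If $G$ is a connected graph with $n\geq 2$ vertices, then \[R(G)\leq GA(G)\leq (n-1)R(G).\] The lower bound is attained if and only if $G\cong P_{2}$, and the upper bound is attained if and only if $G\cong K_{n}$.
   Context: Graphs are finite and simple, with vertex set $V(G)=\{v_1,\dots,v_n\}$ and edge set $E(G)$. $d_i$ is the degree of the vertex $v_i$, and $ij$ denotes the edge joining $v_i$ and $v_j$. The Randić index is $R(G)=\sum_{ij\in E(G)}\frac{1}{\sqrt{d_id_j}}$ and the first geometric-arithmetic index is $GA(G)=\sum_{ij\in E(G)}\frac{\sqrt{d_id_j}}{\frac12(d_i+d_j)}$. $P_k$ and $K_k$ denote the path and the complete graph on $k$ vertices. *)

(* Defs.v *)
From mathcomp Require Import all_boot all_order all_algebra.

Set Implicit Arguments.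
Unset Strict Implicit.
Unset Printing Implicit Defensive.

Import Order.TTheory GRing.Theory Num.Theory.

Record sgraph := SGraph {
  vertex :> finType;
  adj : rel vertex;
  adj_sym : symmetric adj;
  adj_irrefl : irreflexive adj
}.

Definition edges (G : sgraph) : {set {set G}} :=
  [set e | [exists x, exists y, adj x y && (e == [set x; y])]].

Definition degree (G : sgraph) (x : G) : nat := #|[set y | adj x y]|.

Definition connected_graph (G : sgraph) : Prop :=
  forall x y : G, connect (@adj G) x y.

Definition graph_iso (G H : sgraph) : Prop :=
  exists2 f : G -> H, bijective f & forall x y : G, adj (f x) (f y) = adj x y.

Definition path_adj (k : nat) : rel 'I_k :=
  fun i j => (i.+1 == j :> nat) || (j.+1 == i :> nat).

Fact path_adj_sym k : symmetric (@path_adj k).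
Proof. by move=> i j; rewrite /path_adj orbC. Qed.

Fact path_adj_irrefl k : irreflexive (@path_adj k).
Proof. by move=> i; rewrite /path_adj orbb eqn_leq ltnn. Qed.

Definition path_graph (k : nat) : sgraph :=
  SGraph (@path_adj_sym k) (@path_adj_irrefl k).

Definition complete_adj (k : nat) : rel 'I_k := fun i j => i != j.

Fact complete_adj_sym k : symmetric (@complete_adj k).
Proof. by move=> i j; rewrite /complete_adj eq_sym. Qed.

Fact complete_adj_irrefl k : irreflexive (@complete_adj k).
Proof. by move=> i; rewrite /complete_adj eqxx. Qed.

Definition complete_graph (k : nat) : sgraph :=
  SGraph (@complete_adj_sym k) (@complete_adj_irrefl k).

Local Open Scope ring_scope.

(* An edge is the unordered pair of its two distinct endpoints, so for
   e = [set i; j] the product and the sum over v \in e below are d_i d_j and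
   d_i + d_j, and every edge contributes exactly once. *)
Definition randic_index (R : rcfType) (G : sgraph) : R :=
  \sum_(e in edges G) 1 / Num.sqrt (\prod_(v in e) (degree v)%:R).

Definition ga_index (R : rcfType) (G : sgraph) : R :=
  \sum_(e in edges G)
    Num.sqrt (\prod_(v in e) (degree v)%:R)
      / (1 / 2 * \sum_(v in e) (degree v)%:R).

(* Main.v *)
Require Import Defs.
From mathcomp Require Import all_boot all_order all_algebra.
From mathcomp Require Import ring.

Import Order.TTheory GRing.Theory Num.Theory.
Local Open Scope ring_scope.

(** The term of [GA] at an edge with end degrees [a] and [b] is the term of [R]
    multiplied by [2ab / (a + b)], the harmonic mean of [a] and [b].  In a
    connected graph with at least two vertices all degrees lie between [1] and
    [n - 1], and hence so do these harmonic means; summing over the edges gives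
    both inequalities.

    A harmonic mean reaches a bound on its arguments only if both arguments are
    equal to that bound.  So equality between the sums forces all ends of edges,
    that is all vertices, to have degree [1] in the lower case and [n - 1] in
    the upper one ([randic_leif_ga] and [ga_leif_randic]).  A graph is
    [(n - 1)]-regular exactly when it is complete ([regular_complete]), and a
    connected [1]-regular graph is a single edge, which is the complete graph on
    two vertices ([regular1_path2]). *)

(** * Edgewise comparison *)

(** Both bounds on the harmonic mean can be read off from this one identity,
    with [c] the common lower or upper bound of [a] and [b]: the signs of
    [b - c] and [a - c] then determine the sign of the right-hand side. *)
Lemma ga_term_sub_randic_term (R : rcfType) (a b c : R) : 0 < a -> 0 < b ->
  Num.sqrt (a * b) / (1 / 2 * (a + b)) - c * (1 / Num.sqrt (a * b)) =
  (a * (b - c) + b * (a - c)) / (Num.sqrt (a * b) * (a + b)).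
Proof.
move=> a_gt0 b_gt0; have ab_gt0 : 0 < a * b by rewrite mulr_gt0.
have r_neq0 : Num.sqrt (a * b) != 0 by rewrite gt_eqF // sqrtr_gt0.
have s_neq0 : a + b != 0 by rewrite gt_eqF // addr_gt0.
have /(sqr_sqrtr (R := R)) sqr_r := ltW ab_gt0.
have -> : a * (b - c) + b * (a - c) =
          2 * Num.sqrt (a * b) ^+ 2 - c * (a + b) by rewrite sqr_r; ring.
by field; rewrite r_neq0 s_neq0.
Qed.

Lemma weighted_sum_leif (R : numDomainType) (a b u v : R) :
  0 < a -> 0 < b -> 0 <= u -> 0 <= v ->
  0 <= a * u + b * v ?= iff ((u == 0) && (v == 0)).
Proof.
move=> a_gt0 b_gt0 u_ge0 v_ge0.
have au_ge0 : 0 <= a * u by rewrite mulr_ge0 // ltW.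
have bv_ge0 : 0 <= b * v by rewrite mulr_ge0 // ltW.
split; first exact: addr_ge0.
by rewrite eq_sym paddr_eq0 // !mulf_eq0 (gt_eqF a_gt0) (gt_eqF b_gt0).
Qed.

Lemma leif_div0 (R : numFieldType) (x w : R) (C : bool) :
  0 < w -> 0 <= x ?= iff C -> 0 <= x / w ?= iff C.
Proof.
move=> w_gt0 [x_ge0 xC]; split; first by rewrite divr_ge0 // ltW.
by rewrite -xC !(eq_sym 0) mulf_eq0 invr_eq0 (gt_eqF w_gt0) orbF.
Qed.

Lemma leif_of_sub (R : numDomainType) (x y : R) (C : bool) :
  0 <= y - x ?= iff C -> x <= y ?= iff C.
Proof.
case=> ge0 eqC; split; first by rewrite -subr_ge0.
by rewrite -eqC [RHS]eq_sym subr_eq0 eq_sym.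
Qed.

Lemma randic_term_leif_ga_term (R : rcfType) (a b c : R) :
  0 < c -> c <= a -> c <= b ->
  c * (1 / Num.sqrt (a * b)) <= Num.sqrt (a * b) / (1 / 2 * (a + b))
    ?= iff ((a == c) && (b == c)).
Proof.
move=> c_gt0 ca cb; have a_gt0 := lt_le_trans c_gt0 ca.
have b_gt0 := lt_le_trans c_gt0 cb.
apply: leif_of_sub; rewrite ga_term_sub_randic_term //.
apply: leif_div0; first by rewrite mulr_gt0 ?addr_gt0 // sqrtr_gt0 mulr_gt0.
rewrite -(subr_eq0 a) -(subr_eq0 b) andbC.
by apply: weighted_sum_leif; rewrite ?subr_ge0.
Qed.

Lemma ga_term_leif_randic_term (R : rcfType) (a b c : R) :
  0 < a -> 0 < b -> a <= c -> b <= c ->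
  Num.sqrt (a * b) / (1 / 2 * (a + b)) <= c * (1 / Num.sqrt (a * b))
    ?= iff ((a == c) && (b == c)).
Proof.
move=> a_gt0 b_gt0 ac bc.
apply: leif_of_sub; rewrite -opprB ga_term_sub_randic_term // -mulNr.
apply: leif_div0; first by rewrite mulr_gt0 ?addr_gt0 // sqrtr_gt0 mulr_gt0.
rewrite opprD -!mulrN !opprB ![_ == c]eq_sym.
rewrite -(subr_eq0 c a) -(subr_eq0 c b) andbC.
by apply: weighted_sum_leif; rewrite ?subr_ge0.
Qed.

(** * Degrees and edges *)

Lemma degree_le (G : sgraph) (x : G) : (degree x <= #|G|.-1)%N.
Proof.
rewrite -(cardsC1 x) subset_leq_card //; apply/subsetP => y.
by rewrite !inE; apply: contraTneq => ->; rewrite adj_irrefl.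
Qed.

Lemma degree_gt0 (G : sgraph) (x y : G) : adj x y -> (0 < degree x)%N.
Proof. by move=> xy; apply/card_gt0P; exists y; rewrite inE. Qed.

Lemma connected_has_neighbour (G : sgraph) : (1 < #|G|)%N ->
  connected_graph G -> forall x : G, exists y, adj x y.
Proof.
move=> G_gt1 conn x; have : (0 < #|[set~ x]|)%N by rewrite cardsC1 -subn1 subn_gt0.
case/card_gt0P=> z; rewrite !inE; case/connectP: (conn x z) => [[|y p]] /=.
  by move=> _ ->; rewrite eqxx.
by case/andP=> xy _ _ _; exists y.
Qed.

Lemma edgesP (G : sgraph) (e : {set G}) :
  reflect (exists x y, adj x y /\ e = [set x; y]) (e \in edges G).
Proof.
rewrite inE; apply: (iffP existsP) => [[x /existsP[y /andP[xy /eqP ->]]]|].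
  by exists x, y.
by case=> x [y [xy ->]]; exists x; apply/existsP; exists y; rewrite xy eqxx.
Qed.

Lemma adj_neq (G : sgraph) (x y : G) : adj x y -> x != y.
Proof. by apply: contraTneq => ->; rewrite adj_irrefl. Qed.

Lemma big_edge (T : Type) (idx : T) (op : Monoid.com_law idx) (G : sgraph)
    (x y : G) (F : G -> T) : adj x y ->
  \big[op/idx]_(v in [set x; y]) F v = op (F x) (F y).
Proof. by move=> xy; rewrite big_setU1 ?inE ?adj_neq // big_set1. Qed.

(** Without isolated vertices, a condition on the ends of all edges is a
    condition on all vertices. *)
Lemma forall_edge_ends (G : sgraph) (P : pred G) :
  (forall x : G, exists y, adj x y) ->
  [forall (e | e \in edges G), [forall v in e, P v]] = [forall v, P v].
Proof.
move=> nbr; apply/forall_inP/forallP => [Pe v | Pv e _]; last first.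
  by apply/forall_inP => v _; apply: Pv.
have [y vy] := nbr v.
have /Pe/forall_inP -> // : [set v; y] \in edges G by apply/edgesP; exists v, y.
by rewrite !inE eqxx.
Qed.

Lemma forall_in_set2 (T : finType) (x y : T) (P : pred T) :
  [forall v in [set x; y], P v] = P x && P y.
Proof.
apply/forall_inP/andP => [Pv | [Px Py] v].
  by split; apply: Pv; rewrite !inE eqxx ?orbT.
by rewrite !inE => /orP[] /eqP ->.
Qed.

(** * Comparison of the indices *)

Lemma randic_leif_ga (R : rcfType) (G : sgraph) :
  (forall x : G, exists y, adj x y) ->
  randic_index R G <= ga_index R G ?= iff [forall v : G, degree v == 1%N].
Proof.
move=> nbr; rewrite -(forall_edge_ends G (fun v => degree v == 1%N)) //.
apply: leif_sum => e /edgesP[x [y [xy ->]]].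
have yx : adj y x by rewrite adj_sym.
rewrite forall_in_set2 !big_edge //= -[1 / _]mul1r.
rewrite -!(eqr_nat R); apply: randic_term_leif_ga_term => //.
  by rewrite ler1n (degree_gt0 _ _ _ xy).
by rewrite ler1n (degree_gt0 _ _ _ yx).
Qed.

Lemma ga_leif_randic (R : rcfType) (G : sgraph) :
  (forall x : G, exists y, adj x y) ->
  ga_index R G <= #|G|.-1%:R * randic_index R G
    ?= iff [forall v : G, degree v == #|G|.-1].
Proof.
move=> nbr; rewrite -(forall_edge_ends G (fun v => degree v == #|G|.-1)) //.
rewrite mulr_sumr; apply: leif_sum => e /edgesP[x [y [xy ->]]].
have yx : adj y x by rewrite adj_sym.
rewrite forall_in_set2 !big_edge //= -!(eqr_nat R).
apply: ga_term_leif_randic_term; rewrite ?ltr0n ?ler_nat ?degree_le //.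
  exact: degree_gt0 _ _ _ xy.
exact: degree_gt0 _ _ _ yx.
Qed.

(** * Extremal graphs *)

Lemma graph_iso_card (G H : sgraph) : graph_iso G H -> #|G| = #|H|.
Proof. by case=> f /bij_eq_card. Qed.

(** The neighbourhood of [x] is contained in the complement of [x], which has
    [#|G| - 1] elements, so equal cardinals make the two sets equal. *)
Lemma degree_max_adj (G : sgraph) (x : G) :
  degree x = #|G|.-1 <-> forall y, adj x y = (x != y).
Proof.
have sub : [set y | adj x y] \subset [set~ x].
  by apply/subsetP => y; rewrite !inE eq_sym; apply: adj_neq.
have degE : degree x = #|G|.-1 <-> [set y | adj x y] = [set~ x].
  rewrite -(cardsC1 x) /degree; split=> [cardE|->]; last by [].
  by apply/eqP; rewrite eqEcard sub cardE /=.
rewrite degE; split=> [/setP adjE y | adjE].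
  by have := adjE y; rewrite !inE eq_sym.
by apply/setP => y; rewrite !inE adjE eq_sym.
Qed.

Lemma regular_complete (G : sgraph) :
  (forall x : G, degree x = #|G|.-1) <-> graph_iso G (complete_graph #|G|).
Proof.
split=> [reg | [f /bij_inj f_inj fE] x].
  exists (@enum_rank G); first exact: enum_rank_bij.
  move=> x y; have /degree_max_adj -> := reg x.
  by rewrite /= /complete_adj (inj_eq enum_rank_inj).
by apply/degree_max_adj => y; rewrite -fE /= /complete_adj (inj_eq f_inj).
Qed.

(** An edge of a [1]-regular graph has no further neighbours, so by
    connectedness its two ends are all the vertices. *)
Lemma regular1_card (G : sgraph) : (1 < #|G|)%N -> connected_graph G ->
  (forall x : G, degree x = 1%N) -> #|G| = 2.
Proof.
move=> G_gt1 conn reg.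
have uniq_nbr (u v w : G) : adj u v -> adj u w -> v = w.
  have /eqP/cards1P[z zE] := reg u.
  have nbr_z t : adj u t -> t = z by move=> ut; apply/set1P; rewrite -zE inE.
  by move=> /nbr_z -> /nbr_z ->.
have [x _] : exists x : G, x \in G by apply/card_gt0P; apply: ltnW.
have [y xy] := connected_has_neighbour G G_gt1 conn x.
have closed_xy : closed (@adj G) (mem [set x; y]).
  apply: (intro_closed (sym_connect_sym (@adj_sym G))) => u v uv.
  rewrite !inE => /orP[] /eqP uE; rewrite uE in uv.
    by rewrite (uniq_nbr _ _ _ uv xy) eqxx orbT.
  by rewrite (uniq_nbr _ _ x uv) ?eqxx // adj_sym.
have full : [set x; y] = [set: G].
  apply/setP => z; rewrite in_setT.
  by rewrite -(closed_connect closed_xy (conn x z)) !inE eqxx.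
by rewrite -cardsT -full cards2 adj_neq.
Qed.

Lemma path2_complete2 (i j : 'I_2) :
  @adj (path_graph 2) i j = @adj (complete_graph 2) i j.
Proof. by case: i j => [[|[|//]] ?] [[|[|//]] ?]. Qed.

Lemma regular1_path2 (G : sgraph) : (1 < #|G|)%N -> connected_graph G ->
  (forall x : G, degree x = 1%N) <-> graph_iso G (path_graph 2).
Proof.
move=> G_gt1 conn.
have isoE : graph_iso G (path_graph 2) <-> graph_iso G (complete_graph 2).
  by split=> -[f f_bij fE]; exists f => // x y; rewrite -fE path2_complete2.
rewrite isoE; split=> [reg | iso x].
  have G2 := regular1_card G G_gt1 conn reg.
  by rewrite -[X in complete_graph X]G2; apply/regular_complete; rewrite G2.
have G2 : #|G| = 2 by rewrite (graph_iso_card _ _ iso) card_ord.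
rewrite -[X in complete_graph X]G2 in iso.
by have /regular_complete -> := iso; rewrite G2.
Qed.

Theorem theorem2p3 (R : rcfType) (n : nat) (hn : (2 <= n)%N) (G : sgraph)
    (hG : #|G| = n) (hconn : connected_graph G) :
  (randic_index R G <= ga_index R G <= (n%:R - 1) * randic_index R G) /\
  (randic_index R G = ga_index R G <-> graph_iso G (path_graph 2)) /\
  (ga_index R G = (n%:R - 1) * randic_index R G <->
     graph_iso G (complete_graph n)).
Proof.
subst n; have nbr := connected_has_neighbour G hn hconn.
have -> : #|G|%:R - 1 = #|G|.-1%:R :> R by rewrite -subn1 natrB // ltnW.
have [lo loE] := randic_leif_ga R G nbr.
have [up upE] := ga_leif_randic R G nbr.
have regP k : reflect (forall v : G, degree v = k) [forall v : G, degree v == k].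
  exact: 'forall_eqP.
split; first by rewrite lo up.
split; [rewrite -regular1_path2 // | rewrite -regular_complete].
  by split=> [/eqP|reg]; [rewrite loE => /regP | apply/eqP; rewrite loE; apply/regP].
by split=> [/eqP|reg]; [rewrite upE => /regP | apply/eqP; rewrite upE; apply/regP].
Qed.
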